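(* Let $\lambda\ge1$ be an integer. Given a single randomized pass over a stream of the edges of an $n$-vertex graph $G$, succeeding with probability at least $2/3$ at either of the following tasks requires $\Omega(n^2/\lambda^2)$ bits of space: (i) produce a proper $(\kappa+\lambda)$-coloring of $G$; (ii) produce an estimate $\hat\kappa$ with $|\hat\kappa-\kappa|\le\lambda$, where $\kappa=\kappa(G)$. Furthermore, if we require $\lambda=O(\kappa^{1/2-\gamma})$ for some constant $\gamma>0$, then neither task admits a semi-streaming algorithm (one using $\widetilde{O}(n)$ bits of space).
   Context: $\kappa(G)$ is the degeneracy of $G$: the least $k$ such that every induced subgraph has a vertex of degree at most $k$. The stream is a listing of the edges of $G$ in arbitrary order (insertion-only). $\widetilde{O}$ hides polylogarithmic factors in $n$. *)

(* Defs.v *)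
From HB Require Import structures.
From mathcomp Require Import all_boot all_order all_algebra.
From mathcomp Require Import all_classical all_reals all_analysis.

Set Implicit Arguments.
Unset Strict Implicit.
Unset Printing Implicit Defensive.

Import Order.TTheory GRing.Theory Num.Theory.
Local Open Scope classical_set_scope.
Local Open Scope ring_scope.

Record sgraph (n : nat) := SGraph {
  adj : rel 'I_n;
  adj_sym : symmetric adj;
  adj_irrefl : irreflexive adj
}.

Definition edges n (G : sgraph n) : {set {set 'I_n}} :=
  [set [set p.1; p.2]%SET | p in [set p : 'I_n * 'I_n | adj G p.1 p.2]%SET]%SET.

Definition subdeg n (G : sgraph n) (U : {set 'I_n}) (v : 'I_n) : nat :=
  #|[set w in U | adj G v w]%SET|.

Definition degenerate n (G : sgraph n) (k : nat) : bool :=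
  [forall U : {set 'I_n},
     (U != finset.set0) ==> [exists v in U, (subdeg G U v <= k)%N]].

Lemma degenerate_exists n (G : sgraph n) : exists k, degenerate G k.
Proof.
exists n; apply/forallP => U; apply/implyP => /set0Pn[v vU].
apply/existsP; exists v; rewrite vU /=.
by rewrite -[leqRHS]card_ord; exact: max_card.
Qed.

Definition degeneracy n (G : sgraph n) : nat := ex_minn (degenerate_exists G).

Definition is_stream n (G : sgraph n) (s : seq {set 'I_n}) : Prop :=
  uniq s /\ s =i edges G.

(* The [S]-bit memory is the only thing counted as space. All the randomness is
   carried by [seed], whose law is an arbitrary probability measure; the index
   of the current token is an argument of [step], so that fresh coins may be
   used at every token (coins that are kept and re-read are also allowed). *)
Record stream_alg (R : realType) (n S : nat) (Out : Type) := StreamAlg {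
  seed_disp : measure_display;
  seed : measurableType seed_disp;
  law : probability seed R;
  init : seed -> S.-tuple bool;
  step : seed -> nat -> S.-tuple bool -> {set 'I_n} -> S.-tuple bool;
  output : seed -> S.-tuple bool -> Out
}.

Section Run.
Variables (R : realType) (n S : nat) (Out : Type) (A : stream_alg R n S Out).

Fixpoint run_from (w : seed A) (t : nat) (m : S.-tuple bool)
    (s : seq {set 'I_n}) : S.-tuple bool :=
  if s is e :: s' then run_from w t.+1 (step w t m e) s' else m.

Definition result (w : seed A) (s : seq {set 'I_n}) : Out :=
  output w (run_from w 0 (init w) s).

Definition solves (good : sgraph n -> Out -> Prop) : Prop :=
  forall (G : sgraph n) (s : seq {set 'I_n}), is_stream G s ->
    let success := [set w : seed A | good G (result w s)] in
    measurable success /\ ((2 / 3)%:E <= law A success)%E.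

End Run.

Definition solvable_in (R : realType) (n S : nat) (Out : Type)
    (good : sgraph n -> Out -> Prop) : Prop :=
  exists A : stream_alg R n S Out, solves A good.

Definition proper_coloring n (G : sgraph n) (k : nat) (f : 'I_n -> nat) : Prop :=
  (forall v, (f v < k)%N) /\ (forall u v, adj G u v -> f u <> f v).

Definition coloring_task (lam : forall n, sgraph n -> nat) (n : nat)
    (G : sgraph n) (f : 'I_n -> nat) : Prop :=
  proper_coloring G (degeneracy G + lam n G) f.

Definition estimate_task (R : realType) (lam : forall n, sgraph n -> nat)
    (n : nat) (G : sgraph n) (khat : R) : Prop :=
  `|khat - (degeneracy G)%:R| <= (lam n G)%:R.

Definition soft_O_linear (R : realType) (S : nat -> nat) : Prop :=
  exists (C : R) (k n0 : nat), forall n : nat, (n0 <= n)%N ->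
    (S n)%:R <= C * n%:R * ln (n%:R : R) ^+ k.

Definition semi_streaming (R : realType) (Out : nat -> Type)
    (good : forall n, sgraph n -> Out n -> Prop) : Prop :=
  exists S : nat -> nat, soft_O_linear R S /\
    forall n, solvable_in R (S n) (@good n).

(* [lam = O(kappa ^ a)], as the degeneracy grows, over all graphs *)
Definition big_O_degeneracy_pow (R : realType) (lam : forall n, sgraph n -> nat)
    (a : R) : Prop :=
  exists (C : R) (k0 : nat), forall n (G : sgraph n), (k0 <= degeneracy G)%N ->
    (lam n G)%:R <= C * (degeneracy G)%:R `^ a.

(* Main.v *)
Require Import Defs.
From mathcomp Require Import all_classical all_reals all_analysis.
From mathcomp Require Import measurable_realfun.
From mathcomp Require Import all_boot all_order all_algebra.
From mathcomp Require Import zify lra.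

(** Reduction from INDEX with [p ^ 2] bits [x i j]. With [q = 2 lam + 1], take
    blocks [U_i], [V_j^false], [V_j^true] of [q] vertices each, and a set [K] of
    [p q] vertices, so that [4 p q <= n]. Alice joins [U_i] completely to
    [V_j^(x i j)]; Bob, who wants [x i j], makes [U_i :|: K] and
    [V_j^true :|: K] cliques. If [x i j] holds, then [U_i :|: V_j^true :|: K]
    is a clique and the degeneracy is at least [p q + 2 q - 1]; otherwise it
    is at most [p q + q - 1]. The gap [q] exceeds [2 lam], and for colorings
    Bob checks whether the colors on [U_i] and on [V_j^true] are disjoint,
    which [kappa + lam] colors do not permit when the edges are absent.

    For INDEX on [N] bits, fix a seed that is right on two thirds of all pairs
    (input, position). For every decoded word [y], the sum over all words [x] of
    [2 ^ agreement x y] is [3 ^ N]; summing over the [2 ^ S] memory states and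
    using convexity gives [2 ^ S * 3 ^ N >= 2 ^ (N + 2 N / 3)], up to rounding,
    and [2 ^ (5 / 3) > 3]. *)

Set Implicit Arguments.
Unset Strict Implicit.
Unset Printing Implicit Defensive.

Import Order.TTheory GRing.Theory Num.Theory.

(** * A counting bound for INDEX *)

(* [t ^ A * (1 + a - A)] is a supporting line of [t ^ a] at [a = A]; both sides
   are moved so that no truncated subtraction occurs. *)
Lemma expn_supporting_line t A a : 1 < t -> t ^ A * a.+1 <= t ^ a + t ^ A * A.
Proof.
move=> t_gt1; have [leAa|ltaA] := leqP A a.
  rewrite -(subnK leAa) addnC expnD -addnS mulnDr addnC leq_add2r.
  by rewrite leq_mul2l ltn_expl ?orbT.
by apply: leq_trans (leq_addl _ _); rewrite leq_mul2l ltaA orbT.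
Qed.

Lemma expn_mean_le (X : finType) t A (g : X -> nat) : 1 < t ->
  A * #|X| <= \sum_x g x -> t ^ A * #|X| <= \sum_x t ^ g x.
Proof.
move=> t_gt1 le_mean.
have : \sum_x t ^ A * (g x).+1 <= \sum_x (t ^ g x + t ^ A * A).
  by apply: leq_sum => x _; exact: expn_supporting_line.
rewrite big_split -big_distrr /= sum_nat_const.
under eq_bigr do rewrite -addn1.
rewrite big_split /= sum1_card mulnDr => line_le.
rewrite -(leq_add2r (t ^ A * \sum_x g x)) addnC (leq_trans line_le) //.
by rewrite leq_add2l mulnCA leq_mul2l mulnC le_mean orbT.
Qed.

Lemma expn_ratio_le a b k N : a <= b -> 2 * a ^ k <= b ^ k ->
  2 ^ (N %/ k) * a ^ N <= b ^ N.
Proof.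
have expn_le c d e : c <= d -> c ^ e <= d ^ e.
  by case: e => // e; rewrite leq_exp2r.
move=> le_ab le_k; rewrite {2 3}(divn_eq N k) !expnD !(mulnC _ k) !expnM.
by rewrite mulnA -expnMn leq_mul ?expn_le.
Qed.

Section Agreement.
Variable I : finType.
Implicit Types x y : {ffun I -> bool}.

Definition agreement x y := #|[set i | x i == y i]|.

Lemma sum_expn_agreement t y :
  \sum_(x : {ffun I -> bool}) t ^ agreement x y = t.+1 ^ #|I|.
Proof.
transitivity (\sum_(x : {ffun I -> bool})
    \prod_i (if x i == y i then t else 1)).
  apply: eq_bigr => x _; rewrite -big_mkcond /= prod_nat_const /agreement.
  by congr (t ^ _); apply: eq_card => i; rewrite inE.
rewrite -(bigA_distr_bigA (fun i b => if b == y i then t else 1)) /=.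
rewrite -[#|I|]/(#|predT|) -prod_nat_const; apply: eq_bigr => i _.
by rewrite big_bool; case: (y i) => /=; rewrite ?addn1 ?add1n.
Qed.

Lemma agreement_message_count (M : finType) (enc : {ffun I -> bool} -> M)
    (dec : M -> {ffun I -> bool}) A :
  A * 2 ^ #|I| <= \sum_x agreement x (dec (enc x)) ->
  2 ^ (A + #|I|) <= #|M| * 3 ^ #|I|.
Proof.
have card_word : #|{ffun I -> bool}| = 2 ^ #|I| by rewrite card_ffun card_bool.
rewrite expnD -card_word => /(expn_mean_le (isT : 1 < 2))/leq_trans; apply.
apply: (@leq_trans (\sum_x \sum_m 2 ^ agreement x (dec m))).
  by apply: leq_sum => x _; rewrite (bigD1 (enc x)) //= leq_addr.
rewrite exchange_big /=; under eq_bigr do rewrite sum_expn_agreement.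
by rewrite sum_nat_const.
Qed.

Lemma index_code_bound S (enc : {ffun I -> bool} -> S.-tuple bool)
    (dec : S.-tuple bool -> {ffun I -> bool}) :
  2 * (#|I| * 2 ^ #|I|) <= 3 * \sum_x agreement x (dec (enc x)) ->
  #|I| < 15 * S.+1.
Proof.
move: #|I| (@agreement_message_count _ enc dec) => N message_count le_mean.
pose A := (2 * N) %/ 3; have leA : 3 * A <= 2 * N by rewrite mulnC leq_divM.
have {message_count} : 2 ^ (A + N) <= 2 ^ S * 3 ^ N.
  have := message_count A; rewrite card_tuple card_bool; apply.
  by move: le_mean leA; move: (2 ^ N) => E; nia.
rewrite -(@leq_exp2r _ _ 3) // expnMn -!expnM => le_cube.
have le_3227 : 32 ^ N <= 2 ^ (3 * S + 2) * 27 ^ N.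
  rewrite -[32]/(2 ^ 5) -[27]/(3 ^ 3) -!expnM (mulnC 3 N) expnD (mulnC 3 S).
  rewrite mulnAC (leq_trans _ (leq_mul le_cube (leqnn (2 ^ 2)))) // -expnD.
  by rewrite leq_exp2l // /A; lia.
(* [(32 / 27) ^ 5 > 2] *)
have : 2 ^ (N %/ 5) <= 2 ^ (3 * S + 2).
  rewrite -(@leq_pmul2r (27 ^ N)) ?expn_gt0 // (leq_trans _ le_3227) //.
  by apply: expn_ratio_le; lia.
by rewrite leq_exp2l //; lia.
Qed.

End Agreement.

(** * Degeneracy, cliques and colorings *)

Section Degeneracy.
Variables (n : nat) (G : sgraph n).
Implicit Types A B K Q U W : {set 'I_n}.

Lemma degenerateP k :
  reflect (forall U, U != set0 -> exists2 v, v \in U & subdeg G U v <= k)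
          (degenerate G k).
Proof. by apply: (iffP forall_inP) => degG U /degG /exists_inP. Qed.

Lemma degeneracy_degenerate : degenerate G (degeneracy G).
Proof. by rewrite /degeneracy; case: ex_minnP. Qed.

Lemma degeneracy_le k : degenerate G k -> degeneracy G <= k.
Proof. by rewrite /degeneracy; case: ex_minnP => m _; apply. Qed.

Lemma subdeg_lt_card U W v : v \in W ->
  {in U, forall w, adj G v w -> w \in W} -> subdeg G U v < #|W|.
Proof.
move=> vW sub_nbrs; rewrite (cardsD1 v) vW ltnS subset_leq_card //.
apply/subsetP => w; rewrite !inE => /andP[wU vw]; rewrite sub_nbrs // andbT.
by apply: contraTneq vw => ->; rewrite adj_irrefl.
Qed.

Lemma degeneracy_le_order : degeneracy G <= n.
Proof.
apply/degeneracy_le/degenerateP => U /set0Pn[v vU]; exists v => //.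
by rewrite -[leqRHS]card_ord -cardsT ltnW // subdeg_lt_card ?inE.
Qed.

Lemma degenerate_nonadjacent_union k A B K :
  (forall U v, v \notin A :|: B :|: K -> subdeg G U v <= k) ->
  {in A & B, forall v w, ~~ adj G v w} ->
  #|A :|: K| <= k.+1 -> #|B :|: K| <= k.+1 -> degenerate G k.
Proof.
move=> subdeg_out nonadj cardAK cardBK; apply/degenerateP => U /set0Pn[u uU].
have [sub_U|/subsetPn[v vU]] := boolP (U \subset A :|: B :|: K); last first.
  by move=> /subdeg_out le_k; exists v.
have [|/pred0Pn[v /= /andP[vU vA]]] := boolP [disjoint U & A]; last first.
  exists v; rewrite // -ltnS (leq_trans _ cardAK) // subdeg_lt_card //.
    by rewrite in_setU vA.
  move=> w wU; have := subsetP sub_U w wU; rewrite !in_setU orbAC.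
  by case/orP => // wB; rewrite (negPf (nonadj v w vA wB)).
move=> disjUA; have sub_BK : {subset U <= B :|: K}.
  move=> w wU; have := subsetP sub_U w wU.
  by rewrite !in_setU (disjointFr disjUA wU).
exists u; rewrite // -ltnS (leq_trans _ cardBK) // subdeg_lt_card ?sub_BK //.
by move=> w /sub_BK.
Qed.

Definition clique Q := {in Q &, forall v w, v != w -> adj G v w}.

Lemma card_clique_le Q : clique Q -> #|Q| <= (degeneracy G).+1.
Proof.
move=> cliqueQ; have [->|Qn0] := eqVneq Q set0; first by rewrite cards0.
have [v vQ] := degenerateP _ degeneracy_degenerate Q Qn0.
rewrite -ltnS; apply: leq_trans; rewrite (cardsD1 v) vQ add1n ltnS.
apply: subset_leq_card; apply/subsetP => w; rewrite !inE => /andP[wv wQ].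
by rewrite wQ cliqueQ // eq_sym.
Qed.

Lemma proper_coloring_clique_inj k (c : 'I_n -> nat) Q :
  proper_coloring G k c -> clique Q -> {in Q &, injective c}.
Proof.
move=> [_ proper_c] cliqueQ v w vQ wQ eq_c; apply/eqP/contraT => vw.
by case: (proper_c v w (cliqueQ v w vQ wQ vw)).
Qed.

End Degeneracy.

Lemma leq_card_bounded_inj (T : finType) (Q : {set T}) k (c : T -> nat) :
  (forall v, c v < k) -> {in Q &, injective c} -> #|Q| <= k.
Proof.
move=> lt_c inj_c; rewrite -[k]card_ord.
rewrite -(@card_in_imset _ _ (fun v => Ordinal (lt_c v))) ?max_card //.
by move=> v w vQ wQ []; exact: inj_c.
Qed.

Lemma in2_setU3 (T : finType) (A B K : {set T}) (P : T -> T -> Prop) :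
  (forall v w, P v w -> P w v) ->
  {in A :|: K &, forall v w, P v w} -> {in B :|: K &, forall v w, P v w} ->
  {in A & B, forall v w, P v w} -> {in A :|: B :|: K &, forall v w, P v w}.
Proof.
move=> symP PAK PBK PAB v w; rewrite !in_setU.
have [vK|vK] := boolP (v \in K); have [wK|wK] := boolP (w \in K);
  rewrite ?orbT ?orbF.
- by move=> _ _; apply: PAK; rewrite in_setU ?vK ?wK orbT.
- by move=> _ /orP[] win; [apply: PAK|apply: PBK];
    rewrite in_setU ?vK ?win ?orbT.
- by move=> /orP[] vin _; [apply: PAK|apply: PBK];
    rewrite in_setU ?wK ?vin ?orbT.
- case/orP=> vin /orP[] win.
  + by apply: PAK; rewrite in_setU ?vin ?win.
  + exact: PAB.
  + exact/symP/PAB.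
  + by apply: PBK; rewrite in_setU ?vin ?win.
Qed.

Lemma eq_set2 (T : finType) (v w a b : T) : [set v; w] = [set a; b] ->
  v = a /\ w = b \/ v = b /\ w = a.
Proof.
move=> eq_vw; have /set2P vab : v \in [set a; b] by rewrite -eq_vw set21.
have /set2P wab : w \in [set a; b] by rewrite -eq_vw set22.
have /set2P avw : a \in [set v; w] by rewrite eq_vw set21.
have /set2P bvw : b \in [set v; w] by rewrite eq_vw set22.
by case: vab wab avw bvw => -> [] -> [] ? [] ?; subst; auto.
Qed.

Section StreamGraph.
Variables (n : nat) (s : seq {set 'I_n}).

Definition stream_adj : rel 'I_n := fun v w => (v != w) && ([set v; w] \in s).

Lemma stream_adj_sym : symmetric stream_adj.
Proof. by move=> v w; rewrite /stream_adj eq_sym setUC. Qed.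

Lemma stream_adj_irrefl : irreflexive stream_adj.
Proof. by move=> v; rewrite /stream_adj eqxx. Qed.

Definition stream_graph : sgraph n := SGraph stream_adj_sym stream_adj_irrefl.

Lemma is_stream_stream_graph :
  uniq s -> {in s, forall e : {set 'I_n}, #|e| = 2} -> is_stream stream_graph s.
Proof.
move=> uniqs card2; split=> // e; apply/idP/imsetP.
  move=> es; have /eqP/cards2P[v [w [vw def_e]]] := card2 e es.
  by exists (v, w); rewrite // inE /= /stream_adj vw -def_e.
by case=> -[v w]; rewrite inE /= /stream_adj => /andP[_ es ->].
Qed.

End StreamGraph.

(** * The graphs of the reduction *)

Section IndexGraph.
Variables (n p q : nat).

(* The kind [(false, false)] stands for the blocks [U_i], the kind [(true, b)]
   for the blocks [V_j^b], and the kind [(false, true)] for [K]. *)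
Definition vertex : Type := (bool * bool) * ('I_p * 'I_q).

Variable f : vertex -> 'I_n.
Hypothesis f_inj : injective f.

Implicit Types (x : {ffun 'I_p * 'I_p -> bool}) (ij : 'I_p * 'I_p).
Implicit Types c d : 'I_p * 'I_q.

Definition Uvertex c := f ((false, false), c).
Definition Vvertex (b : bool) d := f ((true, b), d).

Definition block kind (J : {set 'I_p}) : {set 'I_n} :=
  [set f (kind, c) | c in [pred c : 'I_p * 'I_q | c.1 \in J]].

Definition Ublock i := block (false, false) [set i].
Definition Vblock (b : bool) j := block (true, b) [set j].
Definition Kblock := block (false, true) setT.

Lemma mem_block kind kind' J c :
  (f (kind, c) \in block kind' J) = (kind == kind') && (c.1 \in J).
Proof.
apply/imsetP/andP => [[c' Jc' /f_inj[-> ->]]|[/eqP-> Jc]]; first by [].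
by exists c.
Qed.

Lemma card_block kind J : #|block kind J| = #|J| * q.
Proof.
rewrite card_imset => [|c d /f_inj[]//].
rewrite -[q in RHS]card_ord -cardX; apply: eq_card => c.
by rewrite !inE andbT.
Qed.

Lemma block_disjoint kind kind' J J' :
  kind != kind' -> [disjoint block kind J & block kind' J'].
Proof.
move=> neq_kind; rewrite disjoints_subset; apply/subsetP => _ /imsetP[c _ ->].
by rewrite inE mem_block negb_and neq_kind.
Qed.

Lemma card_block_setU_Kblock kind i : kind != (false, true) ->
  #|block kind [set i] :|: Kblock| = p * q + q.
Proof.
move=> neqK; rewrite cardsU (disjoint_setI0 (block_disjoint _ _ neqK)).
by rewrite cards0 subn0 !card_block cards1 cardsT card_ord mul1n addnC.
Qed.

Lemma card_UK i : #|Ublock i :|: Kblock| = p * q + q.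
Proof. exact: card_block_setU_Kblock. Qed.

Lemma card_VK b j : #|Vblock b j :|: Kblock| = p * q + q.
Proof. exact: card_block_setU_Kblock. Qed.

Definition alice_edge x (cd : ('I_p * 'I_q) * ('I_p * 'I_q)) : {set 'I_n} :=
  [set Uvertex cd.1; Vvertex (x (cd.1.1, cd.2.1)) cd.2].

(* The length does not depend on [x], so that Bob knows the index of his first
   token without knowing [x]. *)
Definition alice_stream x : seq {set 'I_n} :=
  [seq alice_edge x cd | cd <- enum {: ('I_p * 'I_q) * ('I_p * 'I_q)}].

Definition bob_stream ij : seq {set 'I_n} :=
  enum [set e : {set 'I_n} | (#|e| == 2) &&
    ((e \subset Ublock ij.1 :|: Kblock) ||
     (e \subset Vblock true ij.2 :|: Kblock))].

Definition index_graph x ij : sgraph n :=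
  stream_graph (alice_stream x ++ bob_stream ij).

Lemma size_alice_stream x x' : size (alice_stream x) = size (alice_stream x').
Proof. by rewrite !size_map. Qed.

Lemma alice_edge_inj x : injective (alice_edge x).
Proof.
by move=> [c d] [c' d'] /eq_set2[] [] /f_inj // [->] /f_inj[_ ->].
Qed.

Lemma mem_alice_stream x c b d :
  ([set Uvertex c; Vvertex b d] \in alice_stream x) = (x (c.1, d.1) == b).
Proof.
apply/mapP/eqP => [[[c' d'] _ /eq_set2[][/f_inj]]|<-] //.
  by case=> -> /f_inj[-> ->].
by exists (c, d); rewrite ?mem_enum.
Qed.

Lemma alice_stream_nbr x v w : [set v; w] \in alice_stream x ->
  exists c d, let u := Uvertex c in let u' := Vvertex (x (c.1, d.1)) d in
    v = u /\ w = u' \/ v = u' /\ w = u.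
Proof. by case/mapP=> -[c d] _ /eq_set2; exists c, d. Qed.

Lemma alice_degree_le x v : #|[set w | [set v; w] \in alice_stream x]| <= p * q.
Proof.
suff [g sub_g] : exists g : 'I_p * 'I_q -> 'I_n,
    forall w, [set v; w] \in alice_stream x -> exists c, w = g c.
  rewrite -(card_ord p) -(card_ord q) -card_prod.
  apply: leq_trans (leq_imset_card g _); apply/subset_leq_card/subsetP => w.
  by rewrite inE => /sub_g[c ->]; rewrite imset_f.
have [[c def_v]|not_U] := pselect (exists c, v = Uvertex c).
  exists (fun d => Vvertex (x (c.1, d.1)) d) => w /alice_stream_nbr[c' [d]] /=.
  by rewrite def_v => -[[/f_inj[->] ->]|[/f_inj]] //; exists d.
exists Uvertex => w /alice_stream_nbr[c [d]] /= [[vU _]|[_ ->]].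
  by case: not_U; exists c.
by exists c.
Qed.

Lemma index_graph_stream x ij :
  is_stream (index_graph x ij) (alice_stream x ++ bob_stream ij).
Proof.
apply: is_stream_stream_graph => [|e].
  rewrite cat_uniq enum_uniq (map_inj_uniq (@alice_edge_inj x)) enum_uniq andbT.
  apply/hasPn => e; rewrite mem_enum inE => /andP[_]; apply: contraL.
  case/mapP=> -[c d] _ ->; rewrite !subUset !sub1set !in_setU !mem_block /=.
  by rewrite !andbF.
rewrite mem_cat mem_enum inE => /orP[/mapP[cd _ ->]|/andP[/eqP //]].
by rewrite cards2 (inj_eq f_inj).
Qed.

Lemma index_graph_adj x ij v w : adj (index_graph x ij) v w =
  (v != w) && [|| [set v; w] \in alice_stream x,
    (v \in Ublock ij.1 :|: Kblock) && (w \in Ublock ij.1 :|: Kblock) |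
    (v \in Vblock true ij.2 :|: Kblock) &&
      (w \in Vblock true ij.2 :|: Kblock)].
Proof.
rewrite /= /stream_adj mem_cat; have [//|vw /=] := eqVneq v w.
by rewrite mem_enum inE cards2 vw /= !subUset !sub1set.
Qed.

Lemma clique_UK x ij : clique (index_graph x ij) (Ublock ij.1 :|: Kblock).
Proof. by move=> v w vQ wQ vw; rewrite index_graph_adj vw vQ wQ orbT. Qed.

Lemma clique_VK x ij : clique (index_graph x ij) (Vblock true ij.2 :|: Kblock).
Proof. by move=> v w vQ wQ vw; rewrite index_graph_adj vw vQ wQ !orbT. Qed.

Lemma adj_UV x ij :
  {in Ublock ij.1 & Vblock true ij.2, forall v w,
    adj (index_graph x ij) v w = x ij}.
Proof.
case: ij => i j v w /imsetP[c /set1P c_i ->] /imsetP[d /set1P d_j ->].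
rewrite index_graph_adj !in_setU !mem_block mem_alice_stream (inj_eq f_inj) /=.
by rewrite c_i d_j andbF !orbF eqb_id.
Qed.

Definition bob_vertices ij := Ublock ij.1 :|: Vblock true ij.2 :|: Kblock.

Lemma card_bob_vertices ij : #|bob_vertices ij| = p * q + 2 * q.
Proof.
have disjUV : [disjoint Ublock ij.1 & Vblock true ij.2].
  exact: block_disjoint.
rewrite /bob_vertices -setUA cardsU card_VK setIUr.
rewrite (disjoint_setI0 disjUV) (disjoint_setI0 (block_disjoint _ _ _)) //.
by rewrite setU0 cards0 subn0 card_block cards1; lia.
Qed.

Lemma clique_bob_vertices x ij :
  x ij -> clique (index_graph x ij) (bob_vertices ij).
Proof.
move=> xij; apply: in2_setU3 => [v w|||v w vU wV _]; last by rewrite adj_UV.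
- by rewrite eq_sym adj_sym.
- exact: clique_UK.
- exact: clique_VK.
Qed.

Lemma subdeg_not_bob_le x ij U v :
  v \notin bob_vertices ij -> subdeg (index_graph x ij) U v <= p * q.
Proof.
rewrite !in_setU !negb_or => /andP[/andP[vU vV] vK].
apply: leq_trans (alice_degree_le x v); apply/subset_leq_card/subsetP => w.
rewrite !inE index_graph_adj !in_setU (negPf vU) (negPf vV) (negPf vK) /= orbF.
by case/and3P.
Qed.

Lemma degeneracy_index_graph_ge x ij :
  p * q + q <= (degeneracy (index_graph x ij)).+1.
Proof. by rewrite -(card_UK ij.1) card_clique_le //; exact: clique_UK. Qed.

Lemma degeneracy_index_graph_true x ij :
  x ij -> p * q + 2 * q <= (degeneracy (index_graph x ij)).+1.
Proof.
move=> xij; rewrite -(card_bob_vertices ij).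
exact/card_clique_le/clique_bob_vertices.
Qed.

Lemma degeneracy_index_graph_false x ij : 0 < q ->
  ~~ x ij -> degeneracy (index_graph x ij) < p * q + q.
Proof.
move=> q_gt0 nxij; rewrite -(ltn_predK (ltn_addl _ q_gt0)) ltnS.
apply/degeneracy_le/(@degenerate_nonadjacent_union _ _ _
  (Ublock ij.1) (Vblock true ij.2) Kblock).
- by move=> U v /(subdeg_not_bob_le x U)/leq_trans; apply; lia.
- by move=> v w vU wV; rewrite adj_UV.
- by rewrite card_UK; lia.
- by rewrite card_VK; lia.
Qed.

End IndexGraph.

(** * From streaming algorithms to INDEX *)

Local Open Scope ring_scope.

Lemma first_moment_method (R : realType) (d : measure_display)
    (T : measurableType d) (P : probability T R) (J : finType)
    (E : J -> set T) : (forall j, measurable (E j)) ->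
  exists w, (\sum_j P (E j) <= #|[set j | `[< E j w >]]|%:R%:E)%E.
Proof.
move=> mE; pose count w := #|[set j | `[< E j w >]]|.
have [||m /asboolP[w def_m] max_m] :=
    @ex_maxnP (fun m => `[< exists w, count w = m >]) #|J|.
- by exists (count point); apply/asboolP; exists point.
- by move=> m /asboolP[w <-]; exact: max_card.
have count_sum v : (\sum_j (\1_(E j) v)%:E)%E = (count v)%:R%:E :> \bar R.
  rewrite sumEFin /count -sum1dep_card natr_sum; congr (_%:E).
  rewrite [RHS]big_mkcond; apply: eq_bigr => j _; rewrite indicE.
  by case: asboolP => Ejv; rewrite ?(mem_set Ejv) ?(memNset Ejv).
have m_indic j :
    measurable_fun [set: T]%classic (fun v => (\1_(E j) v)%:E : \bar R).
  by apply/measurable_EFinP; exact: measurable_indic.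
exists w; rewrite -/(count w) def_m.
have -> : (\sum_j P (E j) = \int[P]_v \sum_j (\1_(E j) v)%:E)%E.
  rewrite ge0_integral_sum //.
  by apply: eq_bigr => j _; rewrite integral_indic // classical_sets.setIT.
have -> : m%:R%:E = (\int[P]_v (cst m%:R%:E) v)%E.
  by rewrite integral_cst // [X in (_ * X)%E]probability_setT mule1.
apply: ge0_le_integral => // [v _||v _]; first by apply: sume_ge0.
- exact: emeasurable_sum.
- by rewrite count_sum lee_fin ler_nat max_m //; apply/asboolP; exists v.
Qed.

Section Streaming.
Variables (R : realType) (n S : nat) (Out : Type).

Lemma run_from_cat (A : stream_alg R n S Out) (w : seed A) t m s1 s2 :
  run_from w t m (s1 ++ s2) =
  run_from w (t + size s1) (run_from w t m s1) s2.
Proof.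
elim: s1 t m => [|e s1 IHs] t m /=; first by rewrite addn0.
by rewrite IHs addSnnS.
Qed.

Lemma index_space_bound (I : finType)
    (alice : {ffun I -> bool} -> seq {set 'I_n}) (bob : I -> seq {set 'I_n})
    (G : {ffun I -> bool} -> I -> sgraph n)
    (good : sgraph n -> Out -> Prop) (decode : I -> Out -> bool) :
  (forall x x', size (alice x) = size (alice x')) ->
  (forall x i, is_stream (G x i) (alice x ++ bob i)) ->
  (forall x i o, good (G x i) o -> decode i o = x i) ->
  solvable_in R S good -> (#|I| < 15 * S.+1)%N.
Proof.
move=> size_alice streamG decodeP [A solvesA].
pose E (xi : {ffun I -> bool} * I) := [set w : seed A |
  good (G xi.1 xi.2) (result w (alice xi.1 ++ bob xi.2))]%classic.
have [|w many_good] := @first_moment_method R _ _ (law A) _ E.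
  by move=> [x i]; have [] := solvesA _ _ (streamG x i).
pose enc x := run_from w 0 (init w) (alice x).
pose dec m : {ffun I -> bool} := [ffun i => decode i (output w
  (run_from w (size (alice [ffun=> false])) m (bob i)))].
apply: (@index_code_bound _ S enc dec).
have good_agree x i : good (G x i) (result w (alice x ++ bob i)) ->
    x i = dec (enc x) i.
  move=> /decodeP <-; rewrite ffunE /result run_from_cat add0n.
  by rewrite (size_alice x [ffun=> false]).
have le_agree : (#|[set xi | `[< E xi w >]]| <=
    \sum_x agreement x (dec (enc x)))%N.
  under [leqRHS]eq_bigr do rewrite /agreement -sum1dep_card big_mkcond /=.
  rewrite pair_big -sum1dep_card big_mkcond /=; apply: leq_sum => -[x i] _.
  by case: asboolP => //= /good_agree <-; rewrite eqxx.
have le_mean : (\sum_(xi : {ffun I -> bool} * I) (2 / 3)%:E <=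
    \sum_xi law A (E xi))%E.
  by apply: lee_sum => -[x i] _; have [] := solvesA _ _ (streamG x i).
have {le_mean} := le_trans le_mean many_good.
rewrite sumEFin lee_fin sumr_const card_prod card_ffun card_bool -mulr_natl.
move: le_agree; rewrite -!(ler_nat R) !(natrM _ 2) !(natrM _ 3).
by rewrite (mulnC #|I|); lra.
Qed.

End Streaming.

Section Reduction.
Variables (R : realType) (n p q : nat) (f : vertex p q -> 'I_n).
Hypotheses (f_inj : injective f) (q_gt0 : (0 < q)%N).

Definition reveals_index (Out : Type) (good : sgraph n -> Out -> Prop) :=
  exists decode : 'I_p * 'I_p -> Out -> bool,
    forall x ij o, good (index_graph f x ij) o -> decode ij o = x ij.

Lemma reveals_index_space_bound S Out (good : sgraph n -> Out -> Prop) :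
  reveals_index good -> solvable_in R S good -> (p * p < 15 * S.+1)%N.
Proof.
move=> [decode decodeP]; rewrite -(card_ord p) -card_prod.
exact: index_space_bound (@size_alice_stream _ _ _ f)
  (index_graph_stream f_inj) decodeP.
Qed.

Variables (lam : forall n, sgraph n -> nat) (L : nat).
Hypothesis lam_le :
  forall G : sgraph n, (p * q <= degeneracy G)%N -> (lam G <= L)%N.

Lemma lam_index_graph_le x ij : (lam (index_graph f x ij) <= L)%N.
Proof. by apply: lam_le; have := degeneracy_index_graph_ge f_inj x ij; lia. Qed.

Lemma distinct_colors_inj x ij k c :
  proper_coloring (index_graph f x ij) k c ->
  {in Ublock f ij.1 & Vblock f true ij.2, forall v w, c v != c w} ->
  {in bob_vertices f ij &, injective c}.
Proof.
move=> proper_c distinct.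
apply: (in2_setU3 (P := fun v w => c v = c w -> v = w)) => [v w|||v w vU wV].
- by move=> inj_vw eq_c; rewrite inj_vw.
- exact: proper_coloring_clique_inj proper_c (@clique_UK _ _ _ f x ij).
- exact: proper_coloring_clique_inj proper_c (@clique_VK _ _ _ f x ij).
- by move=> eq_c; have := distinct v w vU wV; rewrite eq_c eqxx.
Qed.

Lemma coloring_reveals_index : (L < q)%N ->
  reveals_index (@coloring_task lam n).
Proof.
move=> L_lt; exists (fun ij c => [forall v in Ublock f ij.1,
  forall w in Vblock f true ij.2, c v != c w]) => x ij c proper_c.
have [xij|nxij] := boolP (x ij).
  apply/forall_inP => v vU; apply/forall_inP => w wV.
  by apply/eqP/(proj2 proper_c); rewrite adj_UV.
apply/negP => /forall_inP distinct.
have inj_c : {in bob_vertices f ij &, injective c}.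
  by apply: distinct_colors_inj proper_c _ => v w /distinct/forall_inP; apply.
have := leq_card_bounded_inj (proj1 proper_c) inj_c.
rewrite (card_bob_vertices f_inj).
have := degeneracy_index_graph_false f_inj q_gt0 nxij.
by have := lam_index_graph_le x ij; lia.
Qed.

Lemma estimate_reveals_index : (2 * L < q)%N ->
  reveals_index (@estimate_task R lam n).
Proof.
move=> L_lt; exists (fun _ (k : R) => (p * q + q + L)%:R <= k) => x ij k close.
have {close} : `|k - (degeneracy (index_graph f x ij))%:R| <= L%:R.
  by apply: le_trans close _; rewrite ler_nat lam_index_graph_le.
rewrite ler_norml => /andP[lo hi].
have [xij|nxij] := boolP (x ij).
  have : (p * q + q + L + L <= degeneracy (index_graph f x ij))%N.
    by have := degeneracy_index_graph_true f_inj xij; lia.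
  by rewrite -(ler_nat R) !natrD; lra.
apply/negbTE; rewrite -ltNge.
have : (degeneracy (index_graph f x ij) + 1 <= p * q + q)%N.
  by have := degeneracy_index_graph_false f_inj q_gt0 nxij; lia.
by rewrite -(ler_nat R) !natrD; lra.
Qed.

End Reduction.

Lemma vertex_embedding n p q : (4 * (p * q) <= n)%N ->
  exists f : vertex p q -> 'I_n, injective f.
Proof.
move=> le_n; have card_le : (#|{: vertex p q}| <= n)%N.
  by rewrite /vertex !card_prod card_bool !card_ord.
exists (fun t => widen_ord card_le (enum_rank t)) => t u /(congr1 val) /= eq_tu.
by apply: enum_rank_inj; exact: val_inj.
Qed.

Definition either_task_solvable_in (R : realType)
    (lam : forall n, sgraph n -> nat) (n S : nat) : Prop :=
  solvable_in R S (@coloring_task lam n) \/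
  solvable_in R S (@estimate_task R lam n).

(* [L] only needs to dominate [lam] on the graphs of the reduction, whose
   degeneracy is about [n / 4]. *)
Lemma task_space_bound (R : realType) (lam : forall n, sgraph n -> nat)
    (L n S : nat) : (0 < L)%N ->
  (forall G : sgraph n,
    (n <= 4 * (degeneracy G + (2 * L).+1) -> lam n G <= L)%N) ->
  either_task_solvable_in R lam n S ->
  (n ^ 2 <= (12 * L) ^ 2 * (60 * maxn 1 S))%N.
Proof.
move=> L_gt0 lam_le solvable_task.
pose q := (2 * L).+1; pose p := (n %/ (4 * q))%N.
have n_lt : (n < p.+1 * (4 * q))%N by apply: ltn_ceil.
have [|f f_inj] := @vertex_embedding n p q; first by rewrite mulnCA leq_divM.
have lam_leL (G : sgraph n) : (p * q <= degeneracy G -> lam n G <= L)%N.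
  by move=> le_pq; apply: lam_le; rewrite -/q; nia.
have sqr_p : (p * p < 15 * S.+1)%N.
  case: solvable_task; apply: (reveals_index_space_bound f_inj).
    by apply: (coloring_reveals_index f_inj _ lam_leL); rewrite /q; lia.
  exact: (estimate_reveals_index R f_inj _ lam_leL).
have n_le : (n <= 12 * L * p.+1)%N.
  by apply: leq_trans (ltnW n_lt) _; rewrite mulnC leq_mul2r /q; lia.
have sqr_pS : (p.+1 ^ 2 <= 60 * maxn 1 S)%N.
  by have := (nat_Cauchy p 1).1; rewrite -mulnn; nia.
rewrite -leq_sqr expnMn in n_le.
by rewrite (leq_trans n_le) // leq_mul2l sqr_pS orbT.
Qed.

(** * Asymptotics *)

Section Asymptotics.
Variable R : realType.
Implicit Types (g gamma x a b C M : R) (lam : forall n, sgraph n -> nat).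

Lemma ln_expn_le_powR g x k : 0 < g -> 1 <= x ->
  ln x ^+ k <= (k.+1%:R / g) ^+ k * x `^ g.
Proof.
move=> g_gt0 x_ge1; pose e := g / k.+1%:R.
have e_gt0 : 0 < e by rewrite divr_gt0 ?ltr0n.
have ln_le : ln x <= k.+1%:R / g * x `^ e.
  rewrite -invf_div ler_pdivlMl // -ln_powR.
  by apply/ltW/ln_sublinear/powR_gt0; lra.
apply: (@le_trans _ _ ((k.+1%:R / g * x `^ e) ^+ k)).
  by rewrite lerXn2r ?nnegrE ?(le_trans _ ln_le) ?ln_ge0.
rewrite exprMn ler_wpM2l ?exprn_ge0 ?divr_ge0 ?(ltW g_gt0) //.
rewrite -powR_mulrn ?powR_ge0 // -powRrM ler_powR //.
by rewrite /e mulrAC ler_pdivrMr ?ltr0n // ler_pM2l // ler_nat.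
Qed.

Lemma powR_natr_unbounded g M : 0 < g ->
  exists n0, forall n, (n0 <= n)%N -> M <= n%:R `^ g.
Proof.
move=> g_gt0; exists (Num.truncn (Num.max 0 M `^ g^-1)).+1 => n le_n.
apply: (@le_trans _ _ (Num.max 0 M)); first by rewrite le_max lexx orbT.
rewrite -[leLHS]powRr1 ?le_max ?lexx //.
rewrite -[in leLHS](mulVf (lt0r_neq0 g_gt0)) powRrM.
rewrite ge0_ler_powR ?nnegrE ?powR_ge0 ?(ltW g_gt0) //.
by rewrite ltW // (lt_le_trans (truncnS_gt _)) // ler_nat.
Qed.

Lemma soft_O_linear_le_powR (S : nat -> nat) g : soft_O_linear R S -> 0 < g ->
  exists D n0, 0 < D /\ forall n, (n0 <= n)%N ->
    (maxn 1 (S n))%:R <= D * n%:R `^ (1 + g).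
Proof.
move=> [C [k [n0 leS]]] g_gt0; pose B := (k.+1%:R / g) ^+ k.
have B_ge0 : 0 <= B by rewrite exprn_ge0 // divr_ge0 // ltW.
exists (1 + `|C| * B), (maxn 1 n0); split=> [|n].
  by rewrite ltr_wpDr // mulr_ge0.
rewrite geq_max => /andP[n_gt0 /leS leSn].
have n_ge1 : 1 <= n%:R :> R by rewrite ler1n.
have pow_ge1 : 1 <= n%:R `^ (1 + g).
  by rewrite -[leLHS](powRr0 n%:R) ler_powR //; lra.
have S_le : (S n)%:R <= `|C| * B * n%:R `^ (1 + g).
  apply: le_trans leSn _; rewrite -!mulrA (le_trans (ler_norm _)) //.
  rewrite normrM ler_wpM2l // ger0_norm ?mulr_ge0 ?exprn_ge0 ?ln_ge0 //.
  rewrite powRD ?pnatr_eq0 -?lt0n ?n_gt0 ?implybT // powRr1 //.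
  by rewrite mulrCA ler_wpM2l ?ln_expn_le_powR.
rewrite mulrDl mul1r; have [_|_] := leqP 1 (S n).
  by rewrite (le_trans S_le) // lerDr; lra.
by rewrite ler_wpDr ?mulr_ge0 ?powR_ge0.
Qed.

Lemma big_O_degeneracy_pow_le_order lam a b : a <= b -> 0 <= b ->
  big_O_degeneracy_pow lam a ->
  exists C k0, 1 <= C /\ forall n (G : sgraph n), (k0 <= degeneracy G)%N ->
    (lam n G)%:R <= C * n%:R `^ b.
Proof.
move=> le_ab b_ge0 [C [k0 le_lam]].
exists (Num.max 1 C), (maxn 1 k0); split=> [|n G]; first by rewrite le_max lexx.
rewrite geq_max => /andP[deg_gt0 /le_lam/le_trans]; apply.
have deg_ge1 : 1 <= (degeneracy G)%:R :> R by rewrite ler1n.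
have le_C : C <= Num.max 1 C by rewrite le_max lexx orbT.
apply: (@le_trans _ _ (Num.max 1 C * (degeneracy G)%:R `^ b)).
  apply: (@le_trans _ _ (Num.max 1 C * (degeneracy G)%:R `^ a)).
    by rewrite ler_wpM2r ?powR_ge0.
  by rewrite ler_wpM2l ?ler_powR // le_max ler01.
rewrite ler_wpM2l ?le_max ?ler01 // ge0_ler_powR ?nnegrE //.
by rewrite ler_nat degeneracy_le_order.
Qed.

Lemma affine_powR_le g b C a x : 1 <= x -> g <= b -> 0 <= a ->
  C + a <= x `^ g -> C * x `^ (b - g) + a <= x `^ b.
Proof.
move=> x_ge1 le_gb a_ge0 le_powR; set z := x `^ (b - g).
have z_ge1 : 1 <= z by rewrite -[leLHS](powRr0 x) ler_powR //; lra.
have x_neq0 : x != 0 by rewrite gt_eqF //; lra.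
have -> : x `^ b = x `^ g * z.
  by rewrite -powRD ?x_neq0 ?implybT // addrC subrK.
by have := ler_wpM2r (le_trans ler01 z_ge1) le_powR; nra.
Qed.

(* On the graphs that matter [kappa] is at least about [n / 4] and at most [n],
   so that [lam] is [O(n ^ (1 / 2 - g))] and [n ^ 2 / lam ^ 2] is
   [Omega(n ^ (1 + 2 * g))]. *)
Lemma task_space_bound_powR lam g C k0 : 0 < g -> g <= 1 / 2 -> 1 <= C ->
  (forall n (G : sgraph n), (k0 <= degeneracy G)%N ->
    (lam n G)%:R <= C * n%:R `^ (1 / 2 - g)) ->
  exists n0, forall n S, (n0 <= n)%N -> either_task_solvable_in R lam n S ->
    n%:R `^ (1 + 2 * g) <= (24 * C) ^+ 2 * (60 * (maxn 1 S)%:R).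
Proof.
move=> g_gt0 g_le C_ge1 le_lam.
have [n0 large] := powR_natr_unbounded (16 * C + (4 * k0%:R + 4)) g_gt0.
exists (maxn 1 n0) => n S; rewrite geq_max => /andP[n_gt0 /large {}large].
move=> solvable_task; have n_ge1 : 1 <= n%:R :> R by rewrite ler1n.
have k0_ge0 : 0 <= k0%:R :> R by [].
pose z : R := n%:R `^ (1 / 2 - g).
have z_ge1 : 1 <= z by rewrite -[leLHS](powRr0 n%:R) ler_powR //; lra.
have Cz_ge1 : 1 <= C * z by nra.
have n_ge : 16 * C * z + (4 * k0%:R + 4) <= n%:R.
  apply: (@le_trans _ _ (n%:R `^ (1 / 2))); first by apply: affine_powR_le; lra.
  by rewrite -[leRHS]powRr1 // ler_powR //; lra.
pose L := (Num.truncn (C * z)).+1.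
have L_le : L%:R <= 2 * (C * z).
  by have := truncn_le (C * z); rewrite /L -natr1; lra.
have lam_le (G : sgraph n) :
    (n <= 4 * (degeneracy G + (2 * L).+1) -> lam n G <= L)%N.
  rewrite -(ler_nat R) (natrM _ 4) natrD -(natr1 (2 * L)) (natrM _ 2) => n_le.
  have le_k0 : (k0 <= degeneracy G)%N by rewrite -(ler_nat R); lra.
  rewrite -(ler_nat R) (le_trans (le_lam _ _ le_k0)) //.
  exact/ltW/truncnS_gt.
have := task_space_bound (isT : (0 < L)%N) lam_le solvable_task.
rewrite -(ler_nat R) natrM !natrX (natrM _ 12) (natrM _ 60) => space_bound.
have def_n2 : n%:R ^+ 2 = z ^+ 2 * n%:R `^ (1 + 2 * g).
  rewrite -!powR_mulrn ?powR_ge0 // -powRrM.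
  rewrite -powRD ?pnatr_eq0 -?lt0n ?n_gt0 ?implybT //.
  by congr (_ `^ _); lra.
have z2_gt0 : 0 < z ^+ 2 by rewrite exprn_gt0 //; lra.
rewrite -(ler_pM2l z2_gt0) -def_n2.
apply: le_trans space_bound _; rewrite [leRHS]mulrA -exprMn ler_wpM2r //.
by rewrite lerXn2r ?nnegrE ?mulr_ge0 //; lra.
Qed.

Lemma no_semi_streaming lam gamma (S : nat -> nat) : 0 < gamma ->
  big_O_degeneracy_pow lam (1 / 2 - gamma) -> soft_O_linear R S ->
  ~ (forall n, either_task_solvable_in R lam n (S n)).
Proof.
move=> gamma_gt0 lamO softS solvable_task; pose g := Num.min gamma (1 / 2).
have g_gt0 : 0 < g by rewrite lt_min gamma_gt0; lra.
have [g_gamma g_half] : g <= gamma /\ g <= 1 / 2 by rewrite !ge_min !lexx orbT.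
have [| |C [k0 [C_ge1 le_lam]]] :=
  big_O_degeneracy_pow_le_order (b := 1 / 2 - g) _ _ lamO; try lra.
have [n0 space_ge] := task_space_bound_powR g_gt0 g_half C_ge1 le_lam.
have [D [n1 [D_gt0 space_le]]] := soft_O_linear_le_powR softS g_gt0.
pose K := (24 * C) ^+ 2 * (60 * D).
have [n2 powR_gt] := powR_natr_unbounded (K + 1) g_gt0.
pose n := (n0 + n1 + n2).+1.
have pow_gt0 : 0 < n%:R `^ (1 + g) :> R by rewrite powR_gt0 ?ltr0n.
have def_pow : n%:R `^ (1 + 2 * g) = n%:R `^ g * n%:R `^ (1 + g).
  by rewrite -powRD ?pnatr_eq0 ?implybT //; congr (_ `^ _); lra.
have [n0n n1n n2n] : [/\ n0 <= n, n1 <= n & n2 <= n]%N.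
  by split; rewrite /n; lia.
suff : n%:R `^ g <= K by have := powR_gt n n2n; lra.
rewrite -(ler_pM2r pow_gt0) -def_pow.
apply: le_trans (space_ge n (S n) n0n (solvable_task n)) _.
by rewrite /K -!mulrA !ler_pM2l ?space_le // ?exprn_gt0; lra.
Qed.

End Asymptotics.

Lemma const_task_space_bound (R : realType) (lam n S : nat) : (0 < lam)%N ->
  either_task_solvable_in R (fun _ _ => lam) n S ->
  (12 ^+ 2 * 60)^-1 * (n%:R ^+ 2 / lam%:R ^+ 2) <= (maxn 1 S)%:R :> R.
Proof.
move=> lam_gt0 solvable_task.
have := task_space_bound lam_gt0 (fun _ _ => leqnn lam) solvable_task.
rewrite -(ler_nat R) natrM !natrX (natrM _ 12) (natrM _ 60) => space_bound.
have lam2_gt0 : 0 < lam%:R ^+ 2 :> R by rewrite exprn_gt0 ?ltr0n.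
rewrite ler_pdivrMl; last by lra.
by rewrite ler_pdivrMr // (le_trans space_bound) // exprMn; lra.
Qed.

(* An algorithm is charged at least one bit ([maxn 1 S]): for [lam >= n] both
   tasks need no memory at all, while [n ^ 2 / lam ^ 2] stays positive. *)
Theorem theorem5p6 (R : realType) :
  (exists c : R, 0 < c /\
     forall lam n S : nat, (1 <= lam)%N ->
       (solvable_in R S (@coloring_task (fun _ _ => lam) n) ->
          c * (n%:R ^+ 2 / lam%:R ^+ 2) <= (maxn 1 S)%:R) /\
       (solvable_in R S (@estimate_task R (fun _ _ => lam) n) ->
          c * (n%:R ^+ 2 / lam%:R ^+ 2) <= (maxn 1 S)%:R)) /\
  (forall (gamma : R) (lam : forall n, sgraph n -> nat),
     0 < gamma ->
     (forall n (G : sgraph n), (1 <= lam n G)%N) ->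
     big_O_degeneracy_pow lam (1 / 2 - gamma) ->
     ~ semi_streaming R (@coloring_task lam) /\
     ~ semi_streaming R (@estimate_task R lam)).
Proof.
split.
  exists (12 ^+ 2 * 60)^-1; split=> [|lam n S lam_gt0].
    by rewrite invr_gt0; lra.
  by split=> solv; apply: const_task_space_bound => //; [left|right].
move=> gamma lam gamma_gt0 _ lamO; split=> -[S [softS solv]].
  by apply: (no_semi_streaming gamma_gt0 lamO softS) => n; left.
by apply: (no_semi_streaming gamma_gt0 lamO softS) => n; right.
Qed.
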